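(* Let $s\ge 1$ be an integer. For any family $F=\{(x-a_i)^{e_i} : 1\le i\le s\}$ with $a_i\in\mathbb{C}$, $e_i\in\mathbb{N}$, $e_i\ge (s-1)s/2$ for all $i$, and the pairs $(a_i,e_i)$ pairwise distinct, the elements of $F$ are linearly independent.
   Context: Linear independence is over $\mathbb{C}$ in the space $\mathbb{C}[x]$. *)

(* Defs.v *)
From HB Require Import structures.
From mathcomp Require Import all_boot all_order all_algebra.
From mathcomp Require Import reals complex.

Set Implicit Arguments.
Unset Strict Implicit.
Unset Printing Implicit Defensive.

Import GRing.Theory.
Local Open Scope ring_scope.

(* The library's [free] requires a finite-dimensional vector space, which
   [{poly K}] is not. *)
Definition linearly_independent (K : fieldType) (V : lmodType K) (I : finType)
    (v : I -> V) : Prop :=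
  forall c : I -> K, \sum_i c i *: v i = 0 -> forall i, c i = 0.

(* Main.v *)
Require Import Defs.
From HB Require Import structures.
From mathcomp Require Import all_boot all_order all_algebra.
From mathcomp Require Import reals complex.
From mathcomp Require Import perm zify ring.

Set Implicit Arguments.
Unset Strict Implicit.
Unset Printing Implicit Defensive.

Import GRing.Theory.
Local Open Scope ring_scope.

(** The proof compares Wronskians, by induction on the number of polynomials.

    Suppose that n+1 of the powers [('X - a_k)^e_k] satisfy a linear relation.
    Every subfamily of n of them is independent by induction, so a nontrivial
    relation has no zero coefficient.  If all the [a_k] coincide, the exponents
    are distinct and independence is clear
    ([concentric_powers_independent]).  Otherwise choose [a_i != a_j].

    Let [W_k] be the Wronskian of the family without its k-th member.  It has
    three properties.
    - [W_k] is nonzero, because the n remaining polynomials are independent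
      ([wronskian_neq0]).
    - Each row of the Wronskian matrix has a large power of ['X - a_p] as a
      common factor, and what remains has small degree: [W_k] is the product
      over [p != k] of [('X - a_p)^(e_p - (n - 1))], times a cofactor [S_k] of
      degree at most [1 + 2 + ... + (n - 1)], which is n choose 2
      ([wronskian_shifted_powers]).
    - The [W_k] are the maximal minors of a matrix with n columns, whose rows
      satisfy the given relation with constant coefficients [c_k].  Hence they
      are proportional to the [c_k] up to sign ([left_kernel_minors]).

    In the proportionality of [W_i] and [W_j] all the powers except two cancel,
    so that [S_j * ('X - a_i)^(e_i - (n - 1))] and
    [S_i * ('X - a_j)^(e_j - (n - 1))] agree up to a nonzero constant.  Since
    [a_i != a_j], the polynomial [('X - a_i)^(e_i - (n - 1))] divides [S_i].
    The bound on [e_i] says exactly that its degree exceeds n choose 2, which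
    is impossible.

    That independent polynomials have a nonzero Wronskian in characteristic 0
    is proved through linear differential equations with polynomial
    coefficients: if the Wronskian of n+1 polynomials vanishes while that of
    the first n does not, expanding along the last row gives an equation of
    order n solved by all n+1 polynomials.  At a nonsingular point, a
    solution is determined by its first n derivatives
    ([ode_singular_point]), so n+1 solutions are dependent. *)

(** * Families and points *)

Lemma linearly_independent_inj (K : fieldType) (V : lmodType K) (I J : finType)
    (v : I -> V) (h : J -> I) :
  injective h -> linearly_independent v -> linearly_independent (v \o h).
Proof.
move=> h_inj v_free c c0 j.
pose d i := \sum_(k | h k == i) c k.
have d0 : \sum_i d i *: v i = 0.
  rewrite -[RHS]c0 [RHS](partition_big h xpredT) //=.
  apply: eq_bigr => i _; rewrite scaler_suml.
  by apply: eq_bigr => k /eqP <-.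
have := v_free d d0 (h j); rewrite /d (big_pred1 j) // => k /=.
by rewrite (inj_eq h_inj).
Qed.

Lemma char0_nonroot (K : fieldType) (p : {poly K}) :
  [pchar K] =i pred0 -> p != 0 -> exists x, ~~ root p x.
Proof.
move=> /pcharf0P K0 p0.
pose s := [seq i%:R : K | i <- iota 0 (size p)].
have s_uniq : uniq s.
  rewrite map_inj_uniq ?iota_uniq // => i j /eqP; rewrite -subr_eq0.
  wlog le_ij : i j / (j <= i)%N.
    by move=> H; case: (leqP j i) => [|/ltnW] /H // Hij;
       rewrite -opprB oppr_eq0 => /Hij.
  rewrite -natrB // K0 subn_eq0 => le_ji.
  by apply/eqP; rewrite eqn_leq le_ij le_ji.
have [s_root|/allPn [x _ nx]] := boolP (all (root p) s); last by exists x.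
by have := max_poly_roots p0 s_root s_uniq; rewrite size_map size_iota ltnn.
Qed.

(** * Derivatives at a zero of given multiplicity *)

(** Only the term of the Leibniz rule in which every derivative falls on the
    power of ['X - a] survives at [a] after division by ['X - a] to the
    [m - j]; this gives the exact order of vanishing of the derivatives. *)
Lemma derivn_mul_XsubCn (R : comNzRingType) (q : {poly R}) (a : R) (m j : nat) :
  (j <= m)%N ->
  exists2 v, (q * ('X - a%:P) ^+ m)^`(j) = v * ('X - a%:P) ^+ (m - j)
    & v.[a] = q.[a] *+ (m ^_ j).
Proof.
elim: j => [|j IHj] lt_jm.
  by exists q; rewrite ?derivn0 ?subn0 ?ffactn0.
have [v vE va] := IHj (ltnW lt_jm).
exists (v^`() * ('X - a%:P) + v *+ (m - j)).
  rewrite derivnS vE derivM deriv_exp derivXsubC mul1r subnS.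
  have [d ->] : exists d, (m - j = d.+1)%N by exists (m - j.+1)%N; lia.
  by rewrite /= exprS [RHS]mulrDl mulrA mulrnAl mulrnAr.
by rewrite hornerD hornerM hornerXsubC subrr mulr0 add0r hornerMn va ffactnSr
  mulrnA.
Qed.

Lemma derivn_XsubCn (R : comNzRingType) (a : R) (m j : nat) :
  (('X - a%:P) ^+ m)^`(j) = ('X - a%:P) ^+ (m - j) *+ (m ^_ j).
Proof.
elim: j => [|j IHj]; first by rewrite derivn0 subn0 ffactn0.
by rewrite derivnS IHj derivMn deriv_exp derivXsubC mul1r -mulrnA ffactnSr
  mulnC -subnS.
Qed.

(** * Wronskians of independent polynomials *)

(** Uniqueness in the Cauchy problem for polynomial solutions: a nonzero
    solution with vanishing initial data at [x] forces the leading coefficient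
    of the equation to vanish at [x].  If [x] is a zero of [y] of order
    [m >= n], then [y^`(n)] vanishes there to order exactly [m - n] while the
    lower derivatives vanish to a strictly larger order, so the equation makes
    [C n] absorb one factor ['X - x]. *)
Lemma ode_singular_point (K : fieldType) (n : nat) (C : nat -> {poly K})
    (y : {poly K}) (x : K) :
  [pchar K] =i pred0 -> y != 0 ->
  (forall j, (j < n)%N -> root y^`(j) x) ->
  \sum_(j < n.+1) y^`(j) * C j = 0 ->
  root (C n) x.
Proof.
move=> /pcharf0P K0 y0 y_init y_ode.
have [m [q]] := multiplicity_XsubC y x; rewrite y0 /= => qx yE.
have ffact_neq0 j : (j <= m)%N -> q.[x] *+ m ^_ j != 0.
  by move=> le_jm; rewrite -mulr_natr mulf_neq0 // K0 -lt0n ffact_gt0.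
have le_nm : (n <= m)%N.
  rewrite leqNgt; apply/negP => lt_mn.
  have [v vE vx] := derivn_mul_XsubCn q x (leqnn m).
  have := y_init m lt_mn; rewrite yE vE subnn mulr1 rootE vx.
  by apply/negP/ffact_neq0.
have [v vE vx] := derivn_mul_XsubCn q x le_nm.
have X_neq0 : ('X - x%:P) ^+ (m - n) != 0 by rewrite expf_neq0 ?polyXsubC_eq0.
have : ('X - x%:P) ^+ (m - n).+1 %| y^`(n) * C n.
  have -> : y^`(n) * C n = - \sum_(j < n) y^`(j) * C j.
    rewrite big_ord_recr /= in y_ode.
    by apply/eqP; rewrite -addr_eq0 addrC; apply/eqP.
  rewrite dvdpNr; apply: (big_ind (fun p => _ %| p)) => [|p r|j _];
    [exact: dvdp0 | exact: dvdp_add |].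
  have [w wE _] := derivn_mul_XsubCn q x (leq_trans (ltnW (ltn_ord j)) le_nm).
  rewrite yE wE; apply: dvdp_mulr; apply: dvdp_mull.
  by apply: dvdp_exp2l; have := ltn_ord j; lia.
rewrite yE vE exprSr -mulrA mulrCA dvdp_mul2l // dvdp_XsubCl rootM.
by rewrite [root v x]rootE vx (negPf (ffact_neq0 n le_nm)).
Qed.

Definition wronskian (K : fieldType) (n : nat) (f : 'I_n -> {poly K}) :
    {poly K} :=
  \det (\matrix_(i < n, j < n) (f i)^`(j)).

(** Independence over the constants implies nonvanishing only in
    characteristic 0: in characteristic p, [1] and ['X^p] have Wronskian 0. *)
Lemma wronskian_neq0 (K : fieldType) (n : nat) (f : 'I_n -> {poly K}) :
  [pchar K] =i pred0 -> linearly_independent f -> wronskian f != 0.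
Proof.
move=> K0; elim: n f => [|n IHn] f f_free.
  by rewrite /wronskian det_mx00 oner_neq0.
apply/negP => /eqP W0.
rewrite /wronskian in W0.
set M := \matrix_(i, j) _ in W0.
(* The cofactors of the last row do not involve the last polynomial; they are
   the coefficients of an equation of order n that every [f i] solves. *)
pose C j := cofactor M ord_max (inord j).
have Cmax : C n != 0.
  have nE : inord n = ord_max :> 'I_n.+1 by apply/val_inj; rewrite /= inordK.
  rewrite /C nE.
  rewrite /cofactor mulf_neq0 ?signr_eq0 //.
  have := IHn _ (linearly_independent_inj (lift_inj (h := ord_max)) f_free).
  congr (\det _ != 0); apply/matrixP => i j; rewrite !mxE /=.
  (* [lift ord_max j] and [j] are the same number, here the order of
     differentiation. *)
  by congr derivn; rewrite /bump leqNgt ltn_ord.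
have f_ode i : \sum_(j < n.+1) (f i)^`(j) * C j = 0.
  have /matrixP/(_ i ord_max) := mul_mx_adj M.
  rewrite W0 !mxE mul0rn => adj0; rewrite -[RHS]adj0; apply: eq_bigr => j _.
  by rewrite !mxE /C inord_val.
have [x Cx] := char0_nonroot K0 Cmax.
(* n+1 vectors of initial data in a space of dimension n: some nontrivial
   combination of the polynomials has zero initial data at x. *)
pose E := \matrix_(i < n.+1, j < n) (f i)^`(j).[x].
have : kermx E != 0.
  by rewrite kermx_eq0 -row_leq_rank -ltnNge ltnS rank_leq_col.
case/rowV0Pn => c /sub_kermxP cE; apply/negP; rewrite negbK.
pose y := \sum_i c 0 i *: f i.
have derivnE j : y^`(j) = \sum_i c 0 i *: (f i)^`(j).
  by rewrite linear_sum; apply: eq_bigr => i _; rewrite linearZ.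
apply/eqP/rowP => i; rewrite mxE; apply: (f_free (c 0)).
apply/eqP; apply: contraNT Cx => y0.
apply: (@ode_singular_point K n C y) => // [j lt_jn|].
  have /rowP/(_ (Ordinal lt_jn)) := cE; rewrite !mxE /= => cE0.
  rewrite rootE derivnE horner_sum -[X in _ == X]cE0; apply/eqP/eq_bigr => k _.
  by rewrite hornerZ mxE.
under eq_bigr do rewrite derivnE mulr_suml.
rewrite exchange_big big1 //= => k _.
under eq_bigr do rewrite -scalerAl.
by rewrite -scaler_sumr f_ode scaler0.
Qed.

(** * Wronskians of shifted powers *)

Lemma size_det_leq (K : fieldType) (n : nat) (M : 'M[{poly K}]_n)
    (d : 'I_n -> nat) :
  (forall i j, size (M i j) <= (d j).+1)%N ->
  (size (\det M) <= (\sum_j d j).+1)%N.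
Proof.
move=> Md; apply: leq_trans (size_sum _ _ _) _; apply/bigmax_leqP => s _.
rewrite mulr_sign (fun_if (fun p : {poly K} => size p)) size_polyN if_same.
apply: leq_trans (size_poly_prod_leq _ _) _.
have -> : (\sum_j d j = \sum_j d (s j))%N.
  exact/reindex_inj/perm_inj.
rewrite leq_subLR addnS ltnS -sum1_card -big_split /=.
by apply: leq_sum => i _; rewrite add1n.
Qed.

(** The k-th derivative of [('X - a)^e] with [k <= n - 1] is a multiple of
    [('X - a)^(e - (n - 1))], with quotient of degree at most [n - 1 - k].
    The common factor comes out of the row, and the quotients have degrees
    bounded column by column. *)
Lemma wronskian_shifted_powers (K : fieldType) (n : nat) (a : 'I_n -> K)
    (e : 'I_n -> nat) :
  (forall i, n.-1 <= e i)%N ->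
  exists2 S : {poly K}, (size S <= 'C(n, 2).+1)%N &
    wronskian (fun i => ('X - (a i)%:P) ^+ e i)
      = (\prod_i ('X - (a i)%:P) ^+ (e i - n.-1)) * S.
Proof.
move=> le_e.
pose S := \matrix_(i < n, j < n) (('X - (a i)%:P) ^+ (n.-1 - j) *+ (e i ^_ j)).
exists (\det S).
  (* The column degrees n-1, ..., 1, 0 add up to n choose 2. *)
  have -> : ('C(n, 2) = \sum_(j < n) (n.-1 - j))%N.
    rewrite -bin2_sum big_mkord [RHS](reindex_inj rev_ord_inj) /=.
    by apply: eq_bigr => j _; have := ltn_ord j; lia.
  apply: size_det_leq => i j; rewrite mxE -scaler_nat.
  by apply: leq_trans (size_scale_leq _ _) _; rewrite size_exp_XsubC.
rewrite /wronskian.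
have -> : \matrix_(i < n, j < n) (('X - (a i)%:P) ^+ e i)^`(j)
    = diag_mx (\row_i ('X - (a i)%:P) ^+ (e i - n.-1)) *m S.
  apply/matrixP => i j; rewrite mul_diag_mx !mxE derivn_XsubCn mulrnAr -exprD.
  by congr (_ ^+ _ *+ _); have := ltn_ord j; have := le_e i; lia.
rewrite det_mulmx det_diag; congr (_ * _).
by apply: eq_bigr => i _; rewrite mxE.
Qed.

(** * Proportional minors *)

(** The maximal minors of a matrix with one more row than columns are
    proportional, up to alternating signs, to any vector of its left kernel.
    Border [A] on the left with the [j]-th unit column to get a square matrix
    [M]: then [c *m M] is concentrated in the first entry, and multiplying by
    the adjugate of [M] gives the identity. *)
Lemma left_kernel_minors (R : comPzRingType) (n : nat) (A : 'M[R]_(n.+1, n))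
    (c : 'rV[R]_n.+1) (i j : 'I_n.+1) :
  c *m A = 0 ->
  c 0 i * ((-1) ^+ j * \det (row' j A)) = c 0 j * ((-1) ^+ i * \det (row' i A)).
Proof.
move=> cA0.
pose M : 'M[R]_(n.+1) := row_mx (delta_mx j 0 : 'cV_n.+1) A.
have M_lift k q : M k (lift 0 q) = A k q.
  have -> : lift 0 q = rshift 1 q by apply: val_inj.
  exact: row_mxEr.
have M_cofactor k : cofactor M k 0 = (-1) ^+ k * \det (row' k A).
  rewrite /cofactor addn0; congr (_ * \det _); apply/matrixP => p q.
  by rewrite [LHS]mxE [LHS]mxE [RHS]mxE M_lift.
have M_col k : M k 0 = (k == j)%:R.
  have -> : 0 = lshift n 0 :> 'I_(1 + n) by apply: val_inj.
  by apply: etrans (row_mxEl _ _ _ _) _; rewrite mxE eqxx andbT.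
have detM : \det M = (-1) ^+ j * \det (row' j A).
  rewrite (expand_det_col M 0) (bigD1 j) //= big1 => [|k /negPf kj].
    by rewrite M_col eqxx mul1r addr0 M_cofactor.
  by rewrite M_col kj mul0r.
have cM : c *m M = c 0 j *: delta_mx 0 0.
  apply/rowP => k; rewrite [RHS]mxE [X in _ = _ * X]mxE eqxx /=.
  case: (unliftP 0 k) => [q|] -> {k}.
    rewrite eq_sym (negPf (neq_lift _ _)) mulr0 mxE.
    move/rowP/(_ q): cA0; rewrite !mxE => cA0q; rewrite -[RHS]cA0q.
    by apply: eq_bigr => k _; rewrite M_lift.
  rewrite eqxx mulr1 mxE (bigD1 j) //= big1 => [|k /negPf kj].
    by rewrite M_col eqxx mulr1 addr0.
  by rewrite M_col kj mulr0.
have /(congr1 (fun B : 'rV_n.+1 => B 0 i)) :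
    c *m M *m \adj M = c *m (\det M)%:M.
  by rewrite -mulmxA mul_mx_adj.
rewrite cM mul_mx_scalar -scalemxAl -rowE !mxE M_cofactor detM => ->.
exact: mulrC.
Qed.

(** * Independence of shifted powers *)

Lemma concentric_powers_independent (K : fieldType) (I : finType) (b : K)
    (e : I -> nat) :
  injective e -> linearly_independent (fun i => ('X - b%:P) ^+ e i : {poly K}).
Proof.
move=> e_inj c c0 i.
have /(congr1 (fun p => (p \Po ('X + b%:P))`_(e i))) := c0.
rewrite comp_poly0 coef0 raddf_sum coef_sum /= (bigD1 i) //=.
rewrite big1 => [|j /negPf ji].
  rewrite addr0 comp_polyZ rmorphXn /= rmorphB /= comp_polyX comp_polyC addrK.
  by rewrite coefZ coefXn eqxx mulr1.
rewrite comp_polyZ rmorphXn /= rmorphB /= comp_polyX comp_polyC addrK.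
by rewrite coefZ coefXn (inj_eq e_inj) eq_sym ji mulr0.
Qed.

(** The heart of the argument, as one step of the induction: when all proper
    subfamilies are independent, a relation that involves every term can only
    hold between powers of one and the same ['X - b]. *)
Lemma full_support_relation_concentric (K : fieldType) (n : nat)
    (a : 'I_n.+1 -> K) (e : 'I_n.+1 -> nat) (c : 'I_n.+1 -> K) (i j : 'I_n.+1) :
  [pchar K] =i pred0 ->
  (forall k, 'C(n.+1, 2) <= e k)%N ->
  (forall k : 'I_n.+1, linearly_independent
     (fun p : 'I_n => ('X - (a (lift k p))%:P) ^+ e (lift k p) : {poly K})) ->
  \sum_k c k *: ('X - (a k)%:P) ^+ e k = 0 ->
  (forall k, c k != 0) ->
  a i = a j.
Proof.
move=> K0 le_e sub_free c_rel c_neq0; apply/eqP/negPn/negP => neq_aij.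
have n_gt0 : (0 < n)%N.
  have : (i != j :> nat) by apply: contraNneq neq_aij => /val_inj ->.
  by have := ltn_ord i; have := ltn_ord j; lia.
(* With this, [e k >= 'C(n.+1, 2)] reads [e k - (n - 1) > 'C(n, 2)]. *)
have binE : ('C(n.+1, 2) = 'C(n, 2) + n)%N by rewrite binS bin1 addnC.
pose A := \matrix_(k < n.+1, q < n) (('X - (a k)%:P) ^+ e k)^`(q).
have cA : \row_k (c k)%:P *m A = 0.
  apply/rowP => q; have /(congr1 (derivn q)) := c_rel.
  rewrite linear_sum linear0 !mxE => cq; rewrite -[RHS]cq.
  by apply: eq_bigr => k _; rewrite !mxE mul_polyC linearZ.
have minorE k : exists2 S, \det (row' k A) =
      (\prod_p ('X - (a (lift k p))%:P) ^+ (e (lift k p) - n.-1)) * S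
    & S != 0 /\ (size S <= 'C(n, 2).+1)%N.
  have [|S sS WE] := @wronskian_shifted_powers K n (a \o lift k) (e \o lift k).
    by move=> p /=; have := le_e (lift k p); lia.
  have := wronskian_neq0 K0 (sub_free k).
  have WA : wronskian (fun p => ('X - (a (lift k p))%:P) ^+ e (lift k p))
      = \det (row' k A).
    by congr (\det _); apply/matrixP => p q; rewrite !mxE.
  rewrite -WA WE => W0; exists S => //; split => //.
  by apply: contraNneq W0 => ->; rewrite mulr0.
have [Si SiE [Si0 sSi]] := minorE i.
have [Sj SjE _] := minorE j.
pose g k := ('X - (a k)%:P) ^+ (e k - n.-1).
pose P := \prod_k g k.
have PE k : P = g k * \prod_p g (lift k p) by rewrite /P (bigD1_ord k).
have P0 : P != 0 by apply/prodf_neq0 => k _; rewrite expf_neq0 ?polyXsubC_eq0.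
have := left_kernel_minors i j cA; rewrite !mxE SiE SjE.
rewrite -[\prod_p _]/(\prod_p g (lift j p)).
rewrite -[X in _ = _ * (_ * (X * _))]/(\prod_p g (lift i p)).
move=> rel.
(* Multiplying by [g i * g j] completes both products to the product [P] over
   all indices, which then cancels. *)
have : P * ((c i)%:P * (-1) ^+ j * (Sj * g i))
    = P * ((c j)%:P * (-1) ^+ i * (Si * g j)).
  rewrite {1}(PE j) (PE i).
  transitivity (g i * g j *
      ((c i)%:P * ((-1) ^+ j * ((\prod_p g (lift j p)) * Sj)))).
    by ring.
  by rewrite rel; ring.
move/(mulfI P0) => relS.
(* [relS] equates [S_j * g i] and [S_i * g j] up to constants, and [g i] is
   coprime to [g j]. *)
have gi_dvd : g i %| Si.
  have cop : coprimep (g i) (g j).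
    rewrite /g coprimep_expl // coprimep_expr //.
    by rewrite coprimep_XsubC2 // subr_eq0 eq_sym.
  rewrite -(Gauss_dvdpl _ cop) -(@dvdpZr _ (c j * (-1) ^+ i)); last first.
    by rewrite mulf_neq0 ?signr_eq0.
  by rewrite -mul_polyC polyCM rmorph_sign -relS mulrA dvdp_mulIr.
have := leq_trans (dvdp_leq Si0 gi_dvd) sSi.
by rewrite size_exp_XsubC; have := le_e i; lia.
Qed.

(** The bound n choose 2 increases with n, so the hypotheses pass to
    subfamilies and induction applies. *)
Lemma shifted_powers_independent (K : fieldType) (n : nat) (a : 'I_n -> K)
    (e : 'I_n -> nat) :
  [pchar K] =i pred0 ->
  (forall i, 'C(n, 2) <= e i)%N ->
  injective (fun i => (a i, e i)) ->
  linearly_independent (fun i => ('X - (a i)%:P) ^+ e i : {poly K}).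
Proof.
move=> K0; elim: n a e => [|n IHn] a e le_e ae_inj c c_rel; first by case.
have sub_free (k : 'I_n.+1) : linearly_independent
    (fun p : 'I_n => ('X - (a (lift k p))%:P) ^+ e (lift k p) : {poly K}).
  apply: (IHn (a \o lift k) (e \o lift k)) => [p|].
    by apply: leq_trans (le_e _); rewrite binS leq_addr.
  by move=> p q /ae_inj /lift_inj.
have [/existsP [k /eqP ck0] i|/existsPn c_neq0] := boolP [exists k, c k == 0].
  have [p ->|-> //] := unliftP k i.
  apply: (sub_free k (c \o lift k)).
  by rewrite -[RHS]c_rel (bigD1_ord k) //= ck0 scale0r add0r.
have aE i : a i = a ord0.
  by apply: full_support_relation_concentric c_rel c_neq0.
apply: (@concentric_powers_independent K _ (a ord0) e).
  by move=> i j eij; apply: ae_inj; rewrite /= eij (aE i) (aE j).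
by rewrite -[RHS]c_rel; apply: eq_bigr => i _; rewrite (aE i).
Qed.

Theorem proposition3p5 (R : realType) (s : nat) (hs : (1 <= s)%N)
    (a : 'I_s -> R[i]) (e : 'I_s -> nat)
    (he : forall i, (((s - 1) * s) %/ 2 <= e i)%N)
    (hinj : injective (fun i => (a i, e i))) :
  linearly_independent (fun i : 'I_s => ('X - (a i)%:P) ^+ e i : {poly R[i]}).
Proof.
apply: shifted_powers_independent hinj; first exact: Num.Theory.pchar_num.
by move=> i; rewrite bin2 -divn2 mulnC -subn1.
Qed.
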